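(* Let $\alpha$ and $\beta$ be two countably infinite ordinals with $\alpha\le\beta$. Then $\alpha$ and $\beta$ are orthogonal if and only if either $\omega+1\le\alpha$, or $\alpha=\omega$ and $\beta<\omega\beta$.
   Context: Two linear orders $\mathcal L$ and $\mathcal M$ on the same set $V$ are orthogonal if the only maps $f:V\to V$ preserving both orders (i.e. $x\,\mathcal L\,y\Rightarrow f(x)\,\mathcal L\,f(y)$ and $x\,\mathcal M\,y\Rightarrow f(x)\,\mathcal M\,f(y)$ for all $x,y\in V$, with $\mathcal L,\mathcal M$ reflexive) are the identity map and the constant maps. Two ordinals $\alpha$ and $\beta$ are orthogonal if there exist two orthogonal linear orders on the same set $V$ with order types $\alpha$ and $\beta$ respectively. $\omega$ is the first infinite ordinal, and $\omega\beta$ denotes the order type of the lexicographical sum of copies of $\omega$ indexed by a chain of type $\beta$ (the ordinal product $\omega\cdot\beta$, i.e. $\beta$ successive copies of $\omega$). *)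

(* Defs.v *)
From mathcomp Require Import all_boot.
From mathcomp Require Import boolp classical_sets functions cardinality wochoice.

Set Implicit Arguments.
Unset Strict Implicit.
Unset Printing Implicit Defensive.

(* [L] and [M] are meant to be reflexive total orders, as in [ord_orthogonal]. *)
Definition orthogonal (V : Type) (L M : rel V) : Prop :=
  forall f : V -> V,
    {homo f : x y / L x y} -> {homo f : x y / M x y} ->
    f =1 id \/ exists c : V, f =1 (fun=> c).

Definition order_iso (T U : Type) (R : rel T) (S : rel U) : Prop :=
  exists2 f : T -> U, bijective f & {mono f : x y / R x y >-> S x y}.

(* An ordinal is represented by a well-ordered type having it as order type;  *)
(* equality of ordinals is therefore [ord_eq], not Leibniz equality.          *)
Record wotype := WOType {
  wo_sort :> Type;
  wo_le : rel wo_sort;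
  wo_le_total : total_order wo_le;
  wo_le_wo : well_order wo_le }.

Arguments wo_le {w} x y.

Definition ord_eq (a b : wotype) : Prop := order_iso (@wo_le a) (@wo_le b).

Definition initial_embedding (a b : wotype) (f : a -> b) : Prop :=
  {mono f : x y / wo_le x y} /\
  forall (x : a) (y : b), wo_le y (f x) -> exists z : a, f z = y.

Definition ord_le (a b : wotype) : Prop :=
  exists f : a -> b, initial_embedding f.

(* The image is a proper initial segment. *)
Definition ord_lt (a b : wotype) : Prop :=
  exists2 f : a -> b, initial_embedding f & exists y : b, forall x : a, f x <> y.

Lemma wo_minimum (a : wotype) (P : a -> Prop) :
  (exists x, P x) -> exists2 z, P z & forall x, P x -> wo_le z x.
Proof.
move=> [x Px]; have [|z [[Pz zmin] _]] := @wo_le_wo a [pred y | `[< P y >]].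
  by exists x; apply/asboolP.
exists z; first exact/asboolP.
by move=> y Py; apply: zmin; apply/asboolP.
Qed.

Lemma omega_total : total_order leq.
Proof.
split; last exact: leq_total.
by split; [split; [exact: leqnn | exact: leq_trans] | exact: anti_leq].
Qed.

Lemma omega_wo : well_order leq.
Proof.
apply: antisymmetric_well_order; first exact: anti_leq.
by move=> A /ex_minnP[m Am mmin]; exists m; split=> // n; exact: mmin.
Qed.

Definition omega : wotype := WOType omega_total omega_wo.

Lemma one_total : total_order (fun _ _ : unit => true).
Proof. by split; [split; [split | move=> [] []] | ]. Qed.

Lemma one_wo : well_order (fun _ _ : unit => true).
Proof.
apply: antisymmetric_well_order; first by move=> [] [].
by move=> A [x Ax]; exists x.
Qed.

Definition ord_one : wotype := WOType one_total one_wo.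

Section Operations.
Variables a b : wotype.

Definition sum_le (x y : a + b) : bool :=
  match x, y with
  | inl x, inl y => wo_le x y
  | inl _, inr _ => true
  | inr _, inl _ => false
  | inr x, inr y => wo_le x y
  end.

Lemma sum_le_total : total_order sum_le.
Proof.
have [[[ar at_] aa] ato] := wo_le_total a.
have [[[br bt] ba] bto] := wo_le_total b.
split; last by case=> x [] y //=.
split; first split.
- by case=> x /=.
- by case=> y [] x [] z //=; [exact: at_ | exact: bt].
- by case=> x [] y //= h; congr (_ _); [exact: aa | exact: ba].
Qed.

Lemma sum_le_wo : well_order sum_le.
Proof.
apply: antisymmetric_well_order => [|A [u Au]].
  by have [[]] := sum_le_total.
have [[x Ax]|noa] := pselect (exists x, inl x \in A).
  have [|z Az zmin] := @wo_minimum a (fun x => inl x \in A); first by exists x.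
  by exists (inl z); split=> // -[] y //=; exact: zmin.
have [|z Az zmin] := @wo_minimum b (fun x => inr x \in A).
  by case: u Au => x Ax; [case: noa; exists x | exists x].
exists (inr z); split=> // -[] y Ay /=; last exact: zmin.
by case: noa; exists y.
Qed.

Definition ord_add : wotype := WOType sum_le_total sum_le_wo.

(* In the ordinal product a . b, that is, b copies of a, the coordinate in b  *)
(* is the dominant one.                                                       *)
Definition lexi_le (x y : b * a) : bool :=
  wo_le x.1 y.1 && (wo_le y.1 x.1 ==> wo_le x.2 y.2).

Lemma lexi_le_total : total_order lexi_le.
Proof.
have [[[ar at_] aa] ato] := wo_le_total a.
have [[[br bt] ba] bto] := wo_le_total b.
split; last first.
  move=> [x1 x2] [y1 y2]; rewrite /lexi_le /=.
  have := bto x1 y1; have := ato x2 y2.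
  by case: (wo_le x1 y1); case: (wo_le y1 x1).
split; first split.
- by move=> [x1 x2]; rewrite /lexi_le /= br ar.
- move=> [y1 y2] [x1 x2] [z1 z2]; rewrite /lexi_le /=.
  move=> /andP[xy1 xy2] /andP[yz1 yz2]; rewrite (bt _ _ _ xy1 yz1) /=.
  apply/implyP => zx1; apply: (at_ y2).
    by apply: (implyP xy2); exact: bt zx1.
  by apply: (implyP yz2); exact: bt xy1.
- move=> [x1 x2] [y1 y2]; rewrite /lexi_le /=.
  move=> /andP[/andP[xy1 xy2] /andP[yx1 yx2]].
  rewrite (ba x1 y1) ?xy1 //; congr (_, _); apply: aa.
  by rewrite (implyP xy2) ?(implyP yx2).
Qed.

Lemma lexi_le_wo : well_order lexi_le.
Proof.
apply: antisymmetric_well_order => [|A [[u v] Auv]].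
  by have [[]] := lexi_le_total.
have [|z [w Azw] zmin] := @wo_minimum b (fun x => exists w, (x, w) \in A).
  by exists u, v.
have [|t At tmin] := @wo_minimum a (fun x => (z, x) \in A); first by exists w.
exists (z, t); split=> // -[x y] Axy; rewrite /lexi_le /=.
have zx : wo_le z x by apply: zmin; exists y.
rewrite zx /=; apply/implyP => xz; apply: tmin.
have [[_ ba] _] := wo_le_total b.
by rewrite (ba z x) ?zx.
Qed.

Definition ord_mul : wotype := WOType lexi_le_total lexi_le_wo.

End Operations.

Definition ord_orthogonal (a b : wotype) : Prop :=
  exists (V : Type) (L M : rel V),
    [/\ total_order L, total_order M,
        order_iso L (@wo_le a), order_iso M (@wo_le b) & orthogonal L M].

(* Main.v *)
Require Import Defs.
From mathcomp Require Import all_boot.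
From mathcomp Require Import boolp classical_sets functions cardinality wochoice.
From mathcomp Require Import zify.

Set Implicit Arguments.
Unset Strict Implicit.
Unset Printing Implicit Defensive.

(** Let [L] and [M] be well-orders on [V] and let [f] preserve both. A fibre of
    [f] is an interval of both orders; hence, when the only intervals common to
    [L] and [M] are trivial, [f] is constant or injective. An injective [f] is
    strictly increasing for both orders, so it moves no point down
    ([strict_expand]), and it preserves inversions, the pairs on which the two
    orders disagree.

    The constructions rest on one rigid bichain of type (omega, omega), the
    core. Its inversion graph is a ray with a pendant leaf at every second edge,
    hung on one end or the other of that edge according to a set of marks
    whose gaps grow. An embedding must translate the ray and respect the leaves,
    so it is the identity. Varying the marks gives countably many bichains such
    that no tail of one embeds into another ([tail_rigid]).

    Longer types are obtained from the core by adding points of three sorts.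
    A point of [X] lies, in [L], between two core points, and, in [M], after the
    core; a point of [Y] does the same with [L] and [M] exchanged; a hub follows
    the core in both orders. The result has types omega + (O + Y) and
    omega + (O + X); unless the core is followed by a single hub and nothing
    else, it has only trivial common intervals ([common_interval_full]); and an
    embedding that maps the core to itself is the identity ([frame_core_id]).

    - If both ordinals are at least omega + 1, take a single hub: no
      point is above it in both orders, hence it is fixed, and the core is exactly what precedes it in both orders. The pair
      (omega + 1, omega + 1) leaves no other point, and is treated with one
      point of [X] and one of [Y] instead ([orthogonal_above_omega]).
    - If [alpha] is omega and [beta] is a successor, its last point is fixed.
      As the [L]-initial segments are finite, everything [L]-below that point
      is fixed too, in particular the first point of [X], which bounds the core
      in [M] ([orthogonal_omega_succ]).
    - If [alpha] is omega and [beta] is the limit ordinal omega . gamma, make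
      each of the gamma blocks of [beta] a rigid bichain with its own marks.
      Either some block has a tail mapped into a single block, and then
      [f] fixes infinitely many points, which are cofinal in [L]; or the image
      of every block meets infinitely many blocks, which yields a strictly increasing map from
      omega . gamma to gamma and contradicts [beta] < omega . [beta]
      ([block_dichotomy], [no_omega_contraction], [orthogonal_omega_limit]).

    Conversely, let [L] have type omega and let [g] embed omega . [beta] into
    [beta]. Run through [V] along [L] and send each [v] into the
    copy of omega that [g] assigns to [v]: whatever the choice, the map
    increases for [M], and each copy is infinite, so the choice can be made
    beyond any finite set for [L] ([not_orthogonal_omega]). *)

(** * A rigid bichain of type (omega, omega) *)

(** The marks of every class lie on squares, whose gaps tend to infinity; the
    2-adic valuation of [n] splits the squares [n * n] into infinitely many
    infinite classes. Marking 0 always spares the ray an exception at its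
    origin, where [p_0] and the leaf of index 0 would otherwise form a common
    interval. *)
Definition mark (c j : nat) : bool :=
  (j == 0) || [exists n : 'I_j.+1, (j == n * n) && (logn 2 n == c)].

Lemma markP c j : 0 < j ->
  reflect (exists2 n, j = n * n & logn 2 n = c) (mark c j).
Proof.
rewrite /mark => j_gt0; rewrite eqn0Ngt j_gt0 /=.
apply: (iffP existsP) => [[n /andP[/eqP jn /eqP nc]]|[n jn nc]].
  by exists n.
have nj : n < j.+1 by nia.
by exists (Ordinal nj) => /=; rewrite -jn nc !eqxx.
Qed.

Lemma unbounded_logn2 c m : exists2 n, m <= n & logn 2 n = c.
Proof.
exists (2 ^ c * m.*2.+1).
  by have := expn_gt0 2 c; nia.
by rewrite lognM ?expn_gt0 // pfactorK // logn_coprime ?addn0 // coprime2n /=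
   odd_double.
Qed.

Lemma mark_shift_right c c' a d :
  (forall j, a <= j -> mark c j = mark c' (j + d)) -> d = 0 /\ c = c'.
Proof.
move=> E; have [n nl nc] := unbounded_logn2 c (a + d).+1.
have nn : 0 < n * n by nia.
have : mark c (n * n) by apply/markP => //; exists n.
rewrite E; last by nia.
case/markP => [|m nm mc]; first by nia.
have mn : m = n.
  have le : n <= m by rewrite leqNgt; apply/negP => lt; nia.
  suff ge : m <= n by lia.
  by rewrite leqNgt; apply/negP => lt; nia.
by rewrite -nc -mc mn; rewrite mn in nm; split=> //; nia.
Qed.

(** Two large squares at a bounded distance are equal, and the square [n * n]
    determines its class; so no translation but the trivial one carries marks
    to marks. *)
Lemma mark_shift c c' a b :
  (forall i, mark c (a + i) = mark c' (b + i)) -> a = b /\ c = c'.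
Proof.
move=> E; have [le|/ltnW le] := leqP a b.
  have [j aj|d0 ->] := @mark_shift_right c c' a (b - a).
    by have := E (j - a); rewrite subnKC // => ->; congr mark; lia.
  by split=> //; lia.
have [j aj|d0 ->] := @mark_shift_right c' c b (a - b).
  by have := E (j - b); rewrite (subnKC aj) => <-; congr mark; lia.
by split=> //; lia.
Qed.

(** The points come in triples [3 * j, 3 * j + 1, 3 * j + 2]: in the usual order
    of [nat] a triple reads leaf, q, p if [j] is marked and q, p, leaf
    otherwise. *)
Definition spineq c j := 3 * j + mark c j.
Definition spinep c j := 3 * j + 1 + mark c j.
Definition leaf c j := if mark c j then 3 * j else 3 * j + 2.

(** The second order: [p_j], its leaf and [q_j] receive the keys 4j, 4j + 2 and
    4j + 5. The last one exceeds the key 4j + 4 of [p_(j+1)], which links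
    consecutive triples: the inversions are the edges of the ray
    p_0 q_0 p_1 q_1 ..., and an edge from the leaf to [p_j] or [q_j]. *)
Definition lkey (c n : nat) : nat :=
  let j := n %/ 3 in
  4 * j + nth 0 (if mark c j then [:: 2; 5; 0] else [:: 5; 0; 2]) (n %% 3).

Lemma lkey_q c j : lkey c (spineq c j) = 4 * j + 5.
Proof.
rewrite /lkey /spineq.
have [-> ->] : (3 * j + mark c j) %/ 3 = j /\
  (3 * j + mark c j) %% 3 = mark c j by lia.
by case: (mark c j).
Qed.

Lemma lkey_p c j : lkey c (spinep c j) = 4 * j.
Proof.
rewrite /lkey /spinep.
have [-> ->] : (3 * j + 1 + mark c j) %/ 3 = j /\
  (3 * j + 1 + mark c j) %% 3 = 1 + mark c j by lia.
by case: (mark c j); rewrite /= addn0.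
Qed.

Lemma lkey_l c j : lkey c (leaf c j) = 4 * j + 2.
Proof.
rewrite /lkey /leaf; case E: (mark c j).
  have [-> ->] : (3 * j) %/ 3 = j /\ (3 * j) %% 3 = 0 by lia.
  by rewrite E.
have [-> ->] : (3 * j + 2) %/ 3 = j /\ (3 * j + 2) %% 3 = 2 by lia.
by rewrite E.
Qed.

Lemma spine_or_leafP c n :
  exists j, [\/ n = spineq c j, n = spinep c j | n = leaf c j].
Proof.
exists (n %/ 3); rewrite /spineq /spinep /leaf; case: (mark _ _) => /=.
  have [|[|]] : n %% 3 = 1 \/ n %% 3 = 2 \/ n %% 3 = 0 by lia.
  - by constructor 1; lia.
  - by constructor 2; lia.
  - by constructor 3; lia.
have [|[|]] : n %% 3 = 0 \/ n %% 3 = 1 \/ n %% 3 = 2 by lia.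
- by constructor 1; lia.
- by constructor 2; lia.
- by constructor 3; lia.
Qed.

Lemma lkey_inj c : injective (lkey c).
Proof.
move=> x y; have [i Ei] := spine_or_leafP c x; have [j Ej] := spine_or_leafP c y.
case: Ei => ->; case: Ej => ->; rewrite ?lkey_q ?lkey_p ?lkey_l => E;
  by [lia | have -> : i = j by lia].
Qed.

Lemma lkey_even c k : exists n, lkey c n = 2 * k.
Proof.
have [E|E] : k = 2 * (k %/ 2) \/ k = 2 * (k %/ 2) + 1 by lia.
  by exists (spinep c (k %/ 2)); rewrite lkey_p; lia.
by exists (leaf c (k %/ 2)); rewrite lkey_l; lia.
Qed.

Definition inverted c x y := (x < y) && (lkey c y < lkey c x).

Lemma invertedP c x y : inverted c x y ->
  exists j, [\/ x = spineq c j /\ y = spinep c j,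
               x = spineq c j /\ y = spinep c j.+1,
               [/\ mark c j, x = leaf c j & y = spinep c j] |
               [/\ ~~ mark c j, x = spineq c j & y = leaf c j] ].
Proof.
case/andP; have [i Ei] := spine_or_leafP c x; have [j Ej] := spine_or_leafP c y.
case: Ei => ->; case: Ej => ->; rewrite ?lkey_q ?lkey_p ?lkey_l => xy lt.
- by rewrite /spineq in xy; lia.
- have [E|E] : j = i \/ j = i.+1 by rewrite /spineq /spinep in xy; lia.
    by rewrite E; exists i; constructor 1.
  by rewrite E; exists i; constructor 2.
- have E : j = i.
    by move: xy; rewrite /spineq /leaf; case: (mark c j); lia.
  exists i; rewrite E; constructor 4; split=> //.
  by move: xy; rewrite E /spineq /leaf; case: (mark c i); lia.
- by rewrite /spinep /spineq in xy; lia.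
- by rewrite /spinep in xy; lia.
- by move: xy; rewrite /spinep /leaf; case: (mark c j); lia.
- by move: xy; rewrite /leaf /spineq; case: (mark c i); lia.
- have E : j = i.
    by move: xy; rewrite /spinep /leaf; case: (mark c i); lia.
  exists i; rewrite E; constructor 3; split=> //.
  by move: xy; rewrite E /spinep /leaf; case: (mark c i) => //; lia.
- by move: xy; rewrite /leaf; case: (mark c i); case: (mark c j); lia.
Qed.

Lemma inverted_qp c j : inverted c (spineq c j) (spinep c j).
Proof. by rewrite /inverted lkey_q lkey_p /spineq /spinep; lia. Qed.

Lemma inverted_qpS c j : inverted c (spineq c j) (spinep c j.+1).
Proof. by rewrite /inverted lkey_q lkey_p /spineq /spinep; lia. Qed.

Lemma inverted_lp c j : mark c j -> inverted c (leaf c j) (spinep c j).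
Proof.
by move=> cj; rewrite /inverted lkey_l lkey_p /leaf /spinep cj; lia.
Qed.

Lemma inverted_ql c j : ~~ mark c j -> inverted c (spineq c j) (leaf c j).
Proof.
move=> /negbTE cj.
by rewrite /inverted lkey_l lkey_q /leaf /spineq cj; lia.
Qed.

Lemma spinep_inj c : injective (spinep c).
Proof. by move=> i j; rewrite /spinep; lia. Qed.

Lemma spineq_inj c : injective (spineq c).
Proof. by move=> i j; rewrite /spineq; lia. Qed.

Lemma ql_neq c i j : spineq c i <> leaf c j.
Proof.
rewrite /spineq /leaf => E; have E2 : i = j by case: (mark c j) E; lia.
by rewrite E2 in E; case: (mark c j) E; lia.
Qed.

Lemma pl_neq c i j : spinep c i <> leaf c j.
Proof.
rewrite /spinep /leaf => E; have E2 : i = j by case: (mark c j) E; lia.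
by rewrite E2 in E; case: (mark c j) E; lia.
Qed.

Section Rigid.
Variables (c d : nat) (h : nat -> nat) (N : nat).
Hypothesis h_lt : forall x y, N <= x -> x < y -> h x < h y.
Hypothesis h_key : forall x y, N <= x -> N <= y ->
  lkey c x < lkey c y -> lkey d (h x) < lkey d (h y).

Lemma tail_inverted x y : N <= x -> inverted c x y -> inverted d (h x) (h y).
Proof.
move=> Nx /andP[xy lt]; apply/andP; split; first exact: h_lt.
by apply: h_key => //; lia.
Qed.

(** A point [q_j] is the lower end of at least two inversions, a leaf of at most
    one, and a point [p_j] of none. *)
Lemma tail_spineq j : N <= spineq c j -> exists a, h (spineq c j) = spineq d a.
Proof.
move=> Nj; have /invertedP[a] := tail_inverted Nj (inverted_qp c j).
case=> [[-> _]|[-> _]|[da hl hp]|[_ -> _]]; try by exists a.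
have /invertedP[b] := tail_inverted Nj (inverted_qpS c j).
have pp : h (spinep c j) < h (spinep c j.+1).
  by apply: h_lt; [move: Nj|]; rewrite /spineq /spinep; lia.
case=> [[-> _]|[-> _]|[db hl' hp']|[_ -> _]]; try by exists b.
have E : a = b.
  by move: hl'; rewrite hl /leaf; case: (mark d a); case: (mark d b); lia.
by move: pp; rewrite hp hp' E ltnn.
Qed.

Lemma tail_inj x y : N <= x -> N <= y -> h x = h y -> x = y.
Proof.
move=> Nx Ny E; case: (ltngtP x y) => // lt.
  by have := h_lt Nx lt; rewrite E ltnn.
by have := h_lt Ny lt; rewrite E ltnn.
Qed.

Lemma inverted_above_q a y : inverted d (spineq d a) y ->
  [\/ y = spinep d a, y = spinep d a.+1 | ~~ mark d a /\ y = leaf d a].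
Proof.
move=> /invertedP[b [[/spineq_inj -> ->]|[/spineq_inj -> ->]|[_ /ql_neq]|]] //.
- by constructor 1.
- by constructor 2.
- by case=> db /spineq_inj -> ->; constructor 3.
Qed.

Lemma inverted_below_p x a : inverted d x (spinep d a.+1) ->
  [\/ x = spineq d a, x = spineq d a.+1 | mark d a.+1 /\ x = leaf d a.+1].
Proof.
move=> /invertedP[b].
case=> [[-> /spinep_inj <-]|[-> /spinep_inj [<-]]|[db -> /spinep_inj E]|] //.
- by constructor 2.
- by constructor 1.
- by constructor 3; rewrite E.
- by case=> _ _ /pl_neq.
Qed.

(** The only spine point inverted with two distinct q points lies between
    them on the ray, so the image of the ray advances one step at a time. *)
Lemma tail_step j a : N <= spineq c j -> h (spineq c j) = spineq d a ->
  h (spineq c j.+1) = spineq d a.+1 /\ h (spinep c j.+1) = spinep d a.+1.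
Proof.
move=> Nj ha; have NS : N <= spineq c j.+1 by move: Nj; rewrite /spineq; lia.
have [b hb] := tail_spineq NS.
have ab : a < b.
  have := @h_lt (spineq c j) (spineq c j.+1) Nj.
  rewrite ha hb /spineq => /(_ ltac:(lia)).
  by case: (ltngtP a b) => // [|->]; lia.
have := tail_inverted Nj (inverted_qpS c j).
have := tail_inverted NS (inverted_qp c j.+1).
rewrite ha hb => /inverted_above_q + /inverted_above_q.
case=> [|| [_]] ->; case=> [|| [_]].
- by move/spinep_inj; lia.
- by move/spinep_inj => E; rewrite E in hb *.
- by move/pl_neq.
- by move/spinep_inj; lia.
- by move/spinep_inj; lia.
- by move/pl_neq.
- by move/esym/pl_neq.
- by move/esym/pl_neq.
- by rewrite /leaf; case: (mark d a); case: (mark d b); lia.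
Qed.

(** The leaf of [j + 1] is sent to a neighbour of the image of its support; the
    neighbours on the spine are already images of spine points, so it is sent
    to a leaf, which shows on which side that leaf hangs. *)
Lemma tail_mark j a : N <= spineq c j -> h (spineq c j) = spineq d a ->
  mark c j.+1 = mark d a.+1.
Proof.
move=> Nj ha; have [hq hp] := tail_step Nj ha.
have NS : N <= spineq c j.+1 by move: Nj; rewrite /spineq; lia.
have [_ hp'] := tail_step NS hq.
have Np : N <= spinep c j.+1 by move: Nj; rewrite /spineq /spinep; lia.
have Np' : N <= spinep c j.+2 by move: Nj; rewrite /spineq /spinep; lia.
have Nl : N <= leaf c j.+1.
  by move: Nj; rewrite /spineq /leaf; case: (mark c j.+1); lia.
case E: (mark c j.+1).
  have := tail_inverted Nl (inverted_lp E); rewrite hp => /inverted_below_p.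
  case=> [|| [-> _]] //; first by rewrite -ha => /(tail_inj Nl Nj)/esym/ql_neq.
  by rewrite -hq => /(tail_inj Nl NS)/esym/ql_neq.
have := tail_inverted NS (inverted_ql (negbT E)); rewrite hq => /inverted_above_q.
case=> [|| [/negbTE -> _]] //; first by rewrite -hp => /(tail_inj Nl Np)/esym/pl_neq.
by rewrite -hp' => /(tail_inj Nl Np')/esym/pl_neq.
Qed.

(** The spine is translated by a constant amount and the marks are carried
    along, so the irregular spacing of the marks forces the amount to be 0. *)
Lemma tail_rigid :
  c = d /\ exists j0, forall i, h (spinep c (j0 + i)) = spinep c (j0 + i).
Proof.
have NN : N <= spineq c N by rewrite /spineq; lia.
have [a ha] := tail_spineq NN.
have Hq i : N <= spineq c (N + i) /\ h (spineq c (N + i)) = spineq d (a + i).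
  split; first by rewrite /spineq; lia.
  elim: i => [|i IH]; first by rewrite !addn0.
  by rewrite !addnS; apply: (proj1 (tail_step _ IH)); rewrite /spineq; lia.
have [|E cd] := @mark_shift c d N.+1 a.+1.
  by move=> i; rewrite !addSn; have [? ?] := Hq i; apply: tail_mark.
case: E => E; split=> //; exists N.+1 => i.
have [Ni hi] := Hq i; rewrite addSn; have [_ ->] := tail_step Ni hi.
by rewrite E cd.
Qed.
End Rigid.

(** Two consecutive points already force some [p_j] and [q_j] into [I]. The keys
    of these two enclose that of [p_(j+1)], so [I] climbs the ray; and since [I]
    is then unbounded for both orders, [p_(i+1)] brings in [q_i], of larger key,
    which precedes [p_i] in the usual order: [I] also goes down the ray. *)
Lemma common_interval_core (c : nat) (I : nat -> Prop) u v :
  (forall x y z, I x -> I z -> x <= y <= z -> I y) ->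
  (forall x y z, I x -> I z -> lkey c x <= lkey c y <= lkey c z -> I y) ->
  I u -> I v -> u < v -> forall n, I n.
Proof.
move=> cM cL Iu Iv uv.
have qpS j : I (spineq c j) -> I (spinep c j) ->
    I (spineq c j.+1) /\ I (spinep c j.+1).
  move=> Iq Ip; have Ip' : I (spinep c j.+1).
    by apply: (cL _ _ _ Ip Iq); rewrite !lkey_p lkey_q; lia.
  by split=> //; apply: (cM _ _ _ Iq Ip'); rewrite /spineq /spinep; lia.
have [j Ip] : exists j, forall i, j <= i -> I (spinep c i).
  suff [j IJ] : exists j, I (spineq c j) /\ I (spinep c j).
    exists j => i ji; apply: (proj2 (A := I (spineq c i))).
    elim: i ji => [|i IH]; first by rewrite leqn0 => /eqP <-.
    by rewrite leq_eqVlt => /orP[/eqP <-|/IH [? ?]] //; apply: qpS.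
  have qp i : I (spineq c i) -> I (spinep c i.+1) ->
      exists j, I (spineq c j) /\ I (spinep c j).
    move=> Iq Ip; exists i.+1; split=> //.
    by apply: (cM _ _ _ Iq Ip); rewrite /spineq /spinep; lia.
  have IS : I u.+1 by apply: (cM _ _ _ Iu Iv); lia.
  (* The first point of a triple is a leaf or a q point, never a p point. *)
  have next i : u.+1 = 3 * i.+1 -> 4 * i + 6 <= lkey c u.+1.
    move=> E; have := lkey_l c i.+1; have := lkey_q c i.+1; move: E.
    rewrite /spineq /leaf; case: (mark c i.+1) => -> /=; last by rewrite addn0; lia.
    by lia.
  have [i [E|E|E]] := spine_or_leafP c u.
  - exists i; rewrite -E; split=> //; suff -> : spinep c i = u.+1 by [].
    by rewrite E /spineq /spinep; lia.
  - move: E; rewrite /spinep; case m: (mark c i) => E.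
      exists i; have Ip : I (spinep c i) by rewrite /spinep m -E.
      split=> //; apply: (cL _ _ _ Ip IS).
      by rewrite lkey_p lkey_q; have := next i; lia.
    case: i m E => // i m E; apply: (qp i); last by rewrite /spinep m -E.
    apply: (cL _ _ _ Iu IS).
    have -> : u = spinep c i.+1 by rewrite /spinep m.
    have -> : (spinep c i.+1).+1 = leaf c i.+1 by rewrite /spinep /leaf m; lia.
    by rewrite lkey_p lkey_q lkey_l; lia.
  - have [lu lu'] : lkey c u = 4 * i + 2 /\ 4 * i + 5 <= lkey c u.+1.
      rewrite {1}E lkey_l; split=> //.
      case m: (mark c i).
        suff -> : u.+1 = spineq c i by rewrite lkey_q.
        by rewrite E /leaf /spineq m; lia.
      by have := next i; rewrite {1}E /leaf m; lia.
    by apply: (qp i); apply: (cL _ _ _ Iu IS); rewrite ?lkey_q ?lkey_p; lia.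
move=> n; have bot i : I (spinep c i) -> I n.
  elim: i => [|i IH] Ii.
    apply: (cL _ _ _ Ii (Ip (j + lkey c n) _)); first by lia.
    by rewrite !lkey_p; lia.
  have Iq : I (spineq c i).
    apply: (cL _ _ _ Ii (Ip (j + i.+2) _)); first by lia.
    by rewrite !lkey_p lkey_q; lia.
  apply: IH; apply: (cM _ _ _ Iq (Ip (j + i.+1) _)); first by lia.
  by rewrite /spineq /spinep; lia.
exact: (bot j (Ip j (leqnn j))).
Qed.

(** * Well-orders *)

Section WellOrder.
Variable a : wotype.
Implicit Types x y z : a.

Definition wo_lt x y := ~~ wo_le y x.

Lemma wo_refl x : wo_le x x.
Proof. by have [[[]]] := wo_le_total a. Qed.

Lemma wo_trans x y z : wo_le x y -> wo_le y z -> wo_le x z.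
Proof. by have [[[_ tr] _] _] := wo_le_total a; exact: tr. Qed.

Lemma wo_anti x y : wo_le x y -> wo_le y x -> x = y.
Proof. by have [[_ an] _] := wo_le_total a => xy yx; apply: an; rewrite xy. Qed.

Lemma wo_ltW x y : wo_lt x y -> wo_le x y.
Proof. by have [_ /(_ x y)/orP[//|yx]] := wo_le_total a; rewrite /wo_lt yx. Qed.

Lemma wo_lt_trans x y z : wo_lt x y -> wo_lt y z -> wo_lt x z.
Proof.
move=> xy yz; apply/negP => zx; move/negP: xy; apply.
exact: wo_trans (wo_ltW yz) zx.
Qed.

Lemma wo_le_lt_trans x y z : wo_le x y -> wo_lt y z -> wo_lt x z.
Proof.
by move=> xy /negP yz; apply/negP => zx; apply: yz; exact: wo_trans zx xy.
Qed.

Lemma wo_lt_le_trans x y z : wo_lt x y -> wo_le y z -> wo_lt x z.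
Proof.
by move=> /negP xy yz; apply/negP => zx; apply: xy; exact: wo_trans yz zx.
Qed.

Lemma wo_ltxx x : ~ wo_lt x x.
Proof. by rewrite /wo_lt wo_refl. Qed.

Lemma wo_lt_neq x y : wo_lt x y -> x <> y.
Proof. by move=> xy E; move: xy; rewrite E => /wo_ltxx. Qed.

Lemma wo_le_neq_lt x y : wo_le x y -> x <> y -> wo_lt x y.
Proof. by move=> xy nxy; apply/negP => yx; apply: nxy; exact: wo_anti. Qed.

Variant wo_cases x y : Prop :=
  | WoLt of wo_lt x y | WoEq of x = y | WoGt of wo_lt y x.

Lemma wo_ltP x y : wo_cases x y.
Proof.
case yx: (wo_le y x); last by apply: WoLt; rewrite /wo_lt yx.
case xy: (wo_le x y); last by apply: WoGt; rewrite /wo_lt xy.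
by apply: WoEq; exact: wo_anti.
Qed.

Lemma wo_ind (P : a -> Prop) :
  (forall x, (forall y, wo_lt y x -> P y) -> P x) -> forall x, P x.
Proof.
move=> IH x; case: (pselect (P x)) => // nPx.
have [z nPz zmin] : exists2 z, ~ P z & forall x, ~ P x -> wo_le z x.
  by apply: (@wo_minimum a (fun x => ~ P x)); exists x.
case: nPz; apply: IH => y yz; case: (pselect (P y)) => // nPy.
by move: yz; rewrite /wo_lt zmin.
Qed.

End WellOrder.

Arguments wo_lt {a} x y.

Section StrictMaps.
Variables a b : wotype.

Definition strict (f : a -> b) := {homo f : x y / wo_lt x y}.

Lemma strict_mono (f : a -> b) : strict f -> {mono f : x y / wo_le x y}.
Proof.
move=> sf x y; case: (wo_ltP x y) => [xy|->|yx]; first 2 last.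
- by rewrite (negbTE (sf _ _ yx)) (negbTE yx).
- by rewrite (wo_ltW (sf _ _ xy)) (wo_ltW xy).
- by rewrite !wo_refl.
Qed.

Lemma mono_strict (f : a -> b) : {mono f : x y / wo_le x y} -> strict f.
Proof. by move=> mf x y; rewrite /wo_lt mf. Qed.

Lemma strict_inj (f : a -> b) : strict f -> injective f.
Proof.
move=> sf x y E; by case: (wo_ltP x y) => // /sf; rewrite E => /wo_ltxx.
Qed.

Lemma homo_inj_strict (f : a -> b) :
  {homo f : x y / wo_le x y} -> injective f -> strict f.
Proof.
move=> hf fi x y xy; apply: wo_le_neq_lt; first by apply: hf; exact: wo_ltW.
by move/fi; exact: wo_lt_neq.
Qed.

End StrictMaps.

Lemma strict_expand (a : wotype) (f : a -> a) :
  strict f -> forall x, wo_le x (f x).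
Proof.
move=> sf x; apply/negPn/negP => lt.
have [z zz zmin] := @wo_minimum a (fun z => wo_lt (f z) z) (ex_intro _ x lt).
by move/negP: (zz); apply; apply: zmin; exact: sf.
Qed.

(** If [x] moved, its iterates would form an infinite increasing sequence
    below the fixed point [t], where the keys [k] leave only finitely many
    places. *)
Lemma strict_fixed_below (a : wotype) (k : a -> nat) (f : a -> a) x t :
  (forall y z, wo_lt y z -> wo_le z t -> k y < k z) ->
  strict f -> f t = t -> wo_le x t -> f x = x.
Proof.
move=> sk sf ft xt; case: (wo_ltP x (f x)) => // [lt|lt]; last first.
  by have := strict_expand sf x; move/negP: lt.
have it n : wo_le (iter n f x) t.
  elim: n => [|n IH] //=; rewrite -[t]ft (strict_mono sf) //.
have ltn n : wo_lt (iter n f x) (iter n.+1 f x).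
  by elim: n => [|n IH] //=; exact: sf.
have kn n : n <= k (iter n f x).
  elim: n => // n IH; apply: leq_ltn_trans IH _.
  by apply: sk (ltn n) _; exact: it.
have : k t < (k t).+1 by [].
rewrite ltnNge => /negP; case; apply: leq_trans (kn _) _.
case: (wo_ltP (iter (k t).+1 f x) t) => [|-> //|].
  by move/sk/(_ (wo_refl _))/ltnW.
by move/negP; rewrite it.
Qed.

Lemma inj_surj_bij (T U : Type) (f : T -> U) :
  injective f -> (forall y, exists x, f x = y) -> bijective f.
Proof.
move=> fi /choice[g gK]; exists g => // x; exact/fi/gK.
Qed.

Section OrderIso.
Variables (T U W : Type) (R : rel T) (S : rel U) (Q : rel W).

Lemma order_iso_refl : order_iso R R.
Proof. by exists id => //; exists id. Qed.

Lemma order_iso_sym : order_iso R S -> order_iso S R.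
Proof.
move=> [f [g fK gK] fm]; exists g; first by exists f.
by move=> x y; rewrite -fm !gK.
Qed.

Lemma order_iso_trans : order_iso R S -> order_iso S Q -> order_iso R Q.
Proof.
move=> [f fb fm] [g gb gm]; exists (g \o f); first exact: bij_comp.
by move=> x y /=; rewrite gm fm.
Qed.
End OrderIso.

Lemma strict_iso (a b : wotype) (f : a -> b) :
  strict f -> (forall y, exists x, f x = y) -> ord_eq a b.
Proof.
move=> sf fs; exists f; last exact: strict_mono.
by apply: inj_surj_bij => //; exact: strict_inj.
Qed.

Lemma ord_eq_strict (a b : wotype) : ord_eq a b -> exists f : a -> b, strict f.
Proof. by move=> [f _ fm]; exists f; exact: mono_strict. Qed.

Section Pullback.
Variables (V : Type) (a : wotype) (i : V -> a).
Hypothesis i_inj : injective i.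

Definition pull_le : rel V := fun x y => wo_le (i x) (i y).

Lemma pull_total : total_order pull_le.
Proof.
split; last by move=> x y; have [_ t] := wo_le_total a; exact: t.
split; first split.
- by move=> x; exact: wo_refl.
- by move=> x y z; exact: wo_trans.
- by move=> x y /andP[xy yx]; apply: i_inj; exact: wo_anti.
Qed.

Lemma pull_wo : well_order pull_le.
Proof.
apply: antisymmetric_well_order => [|A [v Av]]; first by have [[]] := pull_total.
have [|_ [z [Az <-]] zmin] := @wo_minimum a (fun x => exists z, z \in A /\ i z = x).
  by exists (i v), v.
by exists z; split=> // w Aw; apply: zmin; exists w.
Qed.

Definition pullback : wotype := WOType pull_total pull_wo.
End Pullback.

Lemma void_inj : injective (fun v : void => (match v with end : omega)).
Proof. by case. Qed.

Definition ord_zero : wotype := pullback void_inj.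

Definition suborder (a : wotype) (P : a -> Prop) : wotype :=
  pullback (@val_inj _ (fun x => `[< P x >]) {x | `[< P x >]}).

(** * Ordinal arithmetic and comparability *)

Lemma ord_eq_sym (a b : wotype) : ord_eq a b -> ord_eq b a.
Proof. exact: order_iso_sym. Qed.

Lemma ord_eq_trans (b a c : wotype) : ord_eq a b -> ord_eq b c -> ord_eq a c.
Proof. exact: order_iso_trans. Qed.

Lemma ord_eq_add (a a' b b' : wotype) :
  ord_eq a a' -> ord_eq b b' -> ord_eq (ord_add a b) (ord_add a' b').
Proof.
move=> [f [f' fK f'K] fm] [g [g' gK g'K] gm].
pose h (x : ord_add a b) : ord_add a' b' :=
  match x with inl x => inl (f x) | inr y => inr (g y) end.
exists h; last by case=> [x|y] [z|t] //=; rewrite ?fm ?gm.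
exists (fun x => match x with inl x => inl (f' x) | inr y => inr (g' y) end).
  by case=> x /=; rewrite ?fK ?gK.
by case=> x /=; rewrite ?f'K ?g'K.
Qed.

Lemma ord_addA (a b c : wotype) :
  ord_eq (ord_add a (ord_add b c)) (ord_add (ord_add a b) c).
Proof.
exists (fun x => match x with
  | inl x => inl (inl x) | inr (inl y) => inl (inr y) | inr (inr z) => inr z end).
  exists (fun x => match x with
    | inl (inl x) => inl x | inl (inr y) => inr (inl y) | inr z => inr (inr z)
    end).
    by case=> [?|[?|?]].
  by case=> [[?|?]|?].
by case=> [?|[?|?]] [?|[?|?]].
Qed.

Lemma ord_add_emptyl (a b : wotype) : (a -> False) -> ord_eq (ord_add a b) b.
Proof.
move=> a0; apply: ord_eq_sym; exists (fun y => inr y : ord_add a b) => //.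
exists (fun x => match x with inl x => match a0 x with end | inr y => y end) => //.
by case=> // x; case: (a0 x).
Qed.

Lemma ord_add_emptyr (a b : wotype) : (b -> False) -> ord_eq (ord_add a b) a.
Proof.
move=> b0; apply: ord_eq_sym; exists (fun x => inl x : ord_add a b) => //.
exists (fun x => match x with inl x => x | inr y => match b0 y with end end) => //.
by case=> // x; case: (b0 x).
Qed.

Definition tail_ord (a b : wotype) (e : a -> b) : wotype :=
  suborder (fun y : b => forall x, e x <> y).

Lemma tail_ordP (a b : wotype) (e : a -> b) :
  initial_embedding e -> ord_eq (ord_add a (tail_ord e)) b.
Proof.
move=> [em ei].
pose h (x : ord_add a (tail_ord e)) : b :=
  match x with inl x => e x | inr y => val y end.
apply: (@strict_iso _ _ h).
  move=> [x|y] [x'|y'] //=; first exact: (mono_strict em).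
  by move=> _; apply/negP => /ei[z]; have /asboolP/(_ z) := valP y'.
move=> y; case: (pselect (exists x, e x = y)) => [[x <-]|nx].
  by exists (inl x).
have yP : `[< forall x, e x <> y >] by apply/asboolP => x E; apply: nx; exists x.
by exists (inr (exist _ y yP)).
Qed.

Lemma lexi_lt (a b : wotype) (x y : ord_mul a b) :
  wo_lt x y <-> wo_lt x.1 y.1 \/ x.1 = y.1 /\ wo_lt x.2 y.2.
Proof.
case: x y => [x1 x2] [y1 y2] /=.
rewrite [wo_lt _ _]/wo_lt [wo_le _ _]/= /lexi_le /= negb_and negb_imply.
case: (wo_ltP x1 y1) => [lt|->|gt].
- by split=> _; [left | rewrite [~~ _]lt].
- rewrite wo_refl /=; split; first by right.
  by case=> [/wo_ltxx|[]].
- rewrite (wo_ltW gt) (negbTE gt) /=; split=> // -[lt|[E _]].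
    by case: (wo_ltxx (wo_lt_trans lt gt)).
  by move: gt; rewrite E => /wo_ltxx.
Qed.

Lemma ord_le_one (a : wotype) (x : a) : ord_le ord_one a.
Proof.
have [z _ zmin] := @wo_minimum a (fun=> True) (ex_intro _ x I).
exists (fun=> z); split; first by move=> x1 x2; rewrite wo_refl.
by move=> _ y yz; exists tt; apply: wo_anti => //; exact: zmin.
Qed.

(** Having the same rank is a bisimulation between initial segments; taking it
    as an inductive relation replaces a transfinite recursion. *)
Section Comparability.
Variables a b : wotype.

Inductive same_rank (x : a) (y : b) : Prop := SameRank of
  (forall x', wo_lt x' x -> exists2 y', wo_lt y' y & same_rank x' y') &
  (forall y', wo_lt y' y -> exists2 x', wo_lt x' x & same_rank x' y').

Lemma same_rank_fun x y y' : same_rank x y -> same_rank x y' -> y = y'.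
Proof.
elim/wo_ind: x y y' => x IH y y' [h1 h2] [h1' h2'].
case: (wo_ltP y y') => // [/h2'|/h2] [x' x'x r].
  have [y1 y1y r1] := h1 x' x'x.
  by move: y1y; rewrite (IH _ x'x _ _ r1 r) => /wo_ltxx.
have [y1 y1y r1] := h1' x' x'x.
by move: y1y; rewrite (IH _ x'x _ _ r1 r) => /wo_ltxx.
Qed.

Lemma same_rank_lt x x' y y' :
  same_rank x y -> same_rank x' y' -> wo_lt x x' -> wo_lt y y'.
Proof.
move=> r [h _] /h[z zy' r']; by rewrite (same_rank_fun r r').
Qed.
End Comparability.

Lemma same_rank_sym (a b : wotype) (x : a) (y : b) :
  same_rank x y -> same_rank y x.
Proof.
elim/wo_ind: x y => x IH y [h1 h2]; split.
  by move=> y' /h2[x' lt r]; exists x' => //; exact: IH.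
by move=> x' lt; have [y' lt' r] := h1 x' lt; exists y' => //; exact: IH.
Qed.

(** The map that preserves ranks is initial because the points below [f x] have
    the ranks of points below [x]. *)
Lemma same_rank_embedding (a b : wotype) :
  (forall x : a, exists y : b, same_rank x y) ->
  exists f : a -> b, initial_embedding f /\ forall x, same_rank x (f x).
Proof.
move=> /choice[f fr]; exists f; split=> //; split.
  by apply: strict_mono => x x'; apply: same_rank_lt (fr x) (fr x').
move=> x y yfx; case: (wo_ltP y (f x)) => [lt|->|/negP//]; last by exists x.
have [_ /(_ _ lt)[x' _ r]] := fr x.
by exists x'; exact: same_rank_fun (fr x') r.
Qed.

(** If some [x] shares its rank with no point of [b], take it least: every point
    of [b] then has the rank of a point below [x], since a least exception
    would have the rank of [x]. *)
Lemma ord_total (a b : wotype) : ord_le a b \/ ord_lt b a.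
Proof.
have [/same_rank_embedding[f [fi _]]|] :=
  pselect (forall x : a, exists y : b, same_rank x y).
  by left; exists f.
move=> /existsNP/wo_minimum[x nx xmin]; right.
have lower x' : wo_lt x' x -> exists y : b, same_rank x' y.
  by move=> lt; apply/not_existsP => h; move/negP: lt; apply; apply: xmin => -[y /h].
suff all_b (y : b) : exists2 x' : a, wo_lt x' x & same_rank y x'.
  have [|f [fi fr]] := @same_rank_embedding b a.
    by move=> y; have [x' _ r] := all_b y; exists x'.
  exists f => //; exists x => y E; have [x' lt r] := all_b y.
  by apply: nx; exists y; rewrite -E; exact: same_rank_sym.
elim/wo_ind: y => y IH; apply/not_exists2P => h.
case: nx; exists y; split.
  move=> x' lt; have [y' r] := lower x' lt; exists y' => //.
  case: (wo_ltP y' y) => // [E|lt'].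
    by case: (h x') => //; case; rewrite -E; exact: same_rank_sym.
  have [_ /(_ _ lt')[x'' lt'' r'']] := r.
  case: (h x'') => //; case; last exact: same_rank_sym.
  exact: wo_lt_trans lt'' lt.
move=> y' /IH[x' lt r]; exists x' => //; exact: same_rank_sym.
Qed.

(** * Order types omega + rho and omega . rho *)
Section KeyedSum.
Variables (V : Type) (rho : wotype) (i : V -> ord_add omega rho).
Hypothesis i_inj : injective i.
Hypothesis i_inr : forall r, exists v, i v = inr r.
Hypothesis i_inl : forall n, exists v m, n <= m /\ i v = inl m.

Let used n := `[< exists v, i v = inl n >].
Let rk (v : V) : ord_add omega rho :=
  match i v with inl n => inl (count used (iota 0 n)) | inr r => inr r end.

(** An infinite set of natural numbers has type omega, the isomorphism being the
    number of used keys below a given one. *)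
Lemma keyed_sum : ord_eq (pullback i_inj) (ord_add omega rho).
Proof.
have countS n m : count used (iota 0 (n + m)) =
    count used (iota 0 n) + count used (iota n m).
  by rewrite iotaD count_cat.
apply: (@strict_iso _ _ (rk : pullback i_inj -> _)).
  move=> v w; rewrite /rk /wo_lt /= /pull_le.
  case Ev: (i v) => [n|r]; case: (i w) => [m|s] //=.
  rewrite -!ltnNge => nm; rewrite -(subnKC nm) addSnnS countS /=.
  have -> : used n by apply/asboolP; exists v.
  by rewrite -addSnnS -addn1 -addnA leq_add2l; lia.
case=> [m|r]; last by have [v iv] := i_inr r; exists v; rewrite /rk iv.
suff [n un <-] : exists2 n, used n & count used (iota 0 n) = m.
  by move/asboolP: un => [v iv]; exists v; rewrite /rk iv.
have next n0 : exists n, [/\ n0 <= n, used n & count used (iota n0 (n - n0)) = 0].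
  have [v [n [nn0 iv]]] := i_inl n0.
  have ex : exists n, (n0 <= n) && used n.
    by exists n; rewrite nn0; apply/asboolP; exists v.
  case: (ex_minnP ex) => k /andP[n0k uk] kmin; exists k; split=> //.
  apply/eqP; rewrite -leqn0 leqNgt -has_count; apply/hasPn => x.
  rewrite mem_iota subnKC // => /andP[n0x xk]; apply/negP => ux.
  by have := kmin x; rewrite n0x ux => /(_ isT); lia.
elim: m => [|m [n un cn]].
  by have [n [_ un]] := next 0; rewrite subn0; exists n.
have [k [nk uk ck]] := next n.+1; exists k => //.
have -> : k = n + (k - n.+1).+1 by lia.
by rewrite countS /= un cn ck; lia.
Qed.
End KeyedSum.

Section Limit.
Variable a : wotype.
Hypothesis no_max : forall x : a, exists y, wo_lt x y.

Definition limit_points : wotype :=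
  suborder (fun x : a => forall y, wo_lt y x -> exists2 z, wo_lt y z & wo_lt z x).

(** Every point is reached by finitely many successor steps from a unique limit
    point (the least point counts as one). *)
Lemma limit_decomposition : ord_eq (ord_mul omega limit_points) a.
Proof.
have /choice[s sP] : forall x : a,
    exists y, wo_lt x y /\ forall z, wo_lt x z -> wo_le y z.
  by move=> x; have [y xy ymin] := wo_minimum (no_max x); exists y.
have s_lt x : wo_lt x (s x) by have [] := sP x.
have s_le x z : wo_lt x z -> wo_le (s x) z by have [_] := sP x; exact.
pose h (u : ord_mul omega limit_points) : a := iter u.2 s (val u.1).
have iter_lt x n m : n < m -> wo_lt (iter n s x) (iter m s x).
  elim: m => // m IH; rewrite ltnS leq_eqVlt => /orP[/eqP ->|/IH lt] /=.
    exact: s_lt.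
  exact: wo_lt_trans lt (s_lt _).
apply: (@strict_iso _ _ h).
  move=> [w n] [w' n'] /lexi_lt /= [ww'|[<- nn']]; last first.
    by apply: iter_lt; rewrite ltnNge.
  rewrite /h /=; apply: wo_lt_le_trans (_ : wo_lt _ (val w')) _; last first.
    by case: n' => [|n']; [exact: wo_refl | apply: wo_ltW; exact: iter_lt 0 _ _].
  elim: n => //= n IH; have /asboolP/(_ _ IH)[z lt lt'] := valP w'.
  exact: wo_le_lt_trans (s_le _ _ lt) lt'.
elim/wo_ind => x IH.
case: (pselect (forall y, wo_lt y x -> exists2 z, wo_lt y z & wo_lt z x)) => [lx|].
  by exists (exist _ x (introT (asboolP _) lx), 0).
move=> /existsNP[y /not_implyP[yx h']].
have [[w n] Ey] := IH y yx; exists (w, n.+1); rewrite /h /= -/(h (w, n)) Ey.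
apply: wo_anti; first exact: s_le.
case: (wo_ltP x (s y)) => [/wo_ltW //|->|lt]; first exact: wo_refl.
by case: h'; exists (s y).
Qed.
End Limit.

(** * Extending the rigid bichain to longer order types *)

Section Frame.
Variables (O X Y : wotype) (nuX : X -> nat) (nuY : Y -> nat).
Hypotheses (nuX_inj : injective nuX) (nuY_inj : injective nuY).

Inductive point := Core of nat | Hub of O | InX of X | InY of Y.

(** The factors keep room between core keys. Keys of the core are even, and
    every even number is some [lkey] ([lkey_even]), so that each multiple of 4
    is the key of a core point; added points have keys 1 modulo 4, hence two of
    them are always separated by a core point. *)
Definition posL (v : point) : ord_add omega (ord_add O Y) :=
  match v with
  | Core n => inl (2 * lkey 0 n)
  | InX x => inl (4 * nuX x + 5)
  | Hub o => inr (inl o)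
  | InY y => inr (inr y)
  end.

Definition posM (v : point) : ord_add omega (ord_add O X) :=
  match v with
  | Core n => inl (2 * n)
  | InY y => inl (4 * nuY y + 5)
  | Hub o => inr (inl o)
  | InX x => inr (inr x)
  end.

Lemma posL_inj : injective posL.
Proof.
case=> [n|o|x|y] [m|p|z|t] //= [E]; first by congr Core; apply: (@lkey_inj 0); lia.
- by lia.
- by rewrite E.
- by lia.
- by congr InX; apply: nuX_inj; lia.
- by rewrite E.
Qed.

Lemma posM_inj : injective posM.
Proof.
case=> [n|o|x|y] [m|p|z|t] //= [E]; first by congr Core; lia.
- by lia.
- by rewrite E.
- by rewrite E.
- by lia.
- by congr InY; apply: nuY_inj; lia.
Qed.

Definition frameL : wotype := pullback posL_inj.
Definition frameM : wotype := pullback posM_inj.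

Lemma frameL_type : ord_eq frameL (ord_add omega (ord_add O Y)).
Proof.
apply: keyed_sum => [[o|y]|n]; [by exists (Hub o)|by exists (InY y)|].
have [m E] := lkey_even 0 n; exists (Core m), (4 * n) => /=.
by split; [lia | rewrite E; congr inl; lia].
Qed.

Lemma frameM_type : ord_eq frameM (ord_add omega (ord_add O X)).
Proof.
apply: keyed_sum => [[o|x]|n]; [by exists (Hub o)|by exists (InX x)|].
by exists (Core n), (2 * n); split=> //; lia.
Qed.

Let leL : rel point := pull_le posL.
Let leM : rel point := pull_le posM.

Section CommonInterval.
Variable I : point -> Prop.
Hypothesis cL : forall u v w, I u -> I w -> leL u v -> leL v w -> I v.
Hypothesis cM : forall u v w, I u -> I w -> leM u v -> leM v w -> I v.
Hypothesis hub_unique : forall o o' : O, o = o'.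
Hypothesis hub_inner : O -> inhabited (X + Y).

(** Two points outside the core are separated by a core point in one of the two
    orders. *)
Lemma touch_core u v : I u -> I v -> u <> v -> exists n, I (Core n).
Proof.
have XX x x' : nuX x < nuX x' -> I (InX x) -> I (InX x') -> exists n, I (Core n).
  move=> lt Ix Ix'; have [n E] := lkey_even 0 (nuX x + 2); exists n.
  by apply: (cL Ix Ix'); rewrite /leL /pull_le /= E; lia.
have YY y y' : nuY y < nuY y' -> I (InY y) -> I (InY y') -> exists n, I (Core n).
  move=> lt Iy Iy'; exists (2 * nuY y + 3).
  by apply: (cM Iy Iy'); rewrite /leM /pull_le /=; lia.
have XH x o : I (InX x) -> I (Hub o) -> exists n, I (Core n).
  move=> Ix Io; have [n E] := lkey_even 0 (nuX x + 2); exists n.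
  by apply: (cL Ix Io); rewrite /leL /pull_le //= E; lia.
have XY x y : I (InX x) -> I (InY y) -> exists n, I (Core n).
  move=> Ix Iy; have [n E] := lkey_even 0 (nuX x + 2); exists n.
  by apply: (cL Ix Iy); rewrite /leL /pull_le //= E; lia.
have YH y o : I (InY y) -> I (Hub o) -> exists n, I (Core n).
  move=> Iy Io; exists (2 * nuY y + 3).
  by apply: (cM Iy Io); rewrite /leM /pull_le //=; lia.
case: u v => [n|o|x|y] [m|p|x'|y'] Iu Iv uv; try (by exists n); try (by exists m).
- by case: uv; rewrite (hub_unique o p).
- exact: XH Iv Iu.
- exact: YH Iv Iu.
- exact: XH Iu Iv.
- case: (ltngtP (nuX x) (nuX x')) => [lt|lt|/nuX_inj E]; first exact: XX Iu Iv.
    exact: XX Iv Iu.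
  by case: uv; rewrite E.
- exact: XY Iu Iv.
- exact: YH Iu Iv.
- exact: XY Iv Iu.
- case: (ltngtP (nuY y) (nuY y')) => [lt|lt|/nuY_inj E]; first exact: YY Iu Iv.
    exact: YY Iv Iu.
  by case: uv; rewrite E.
Qed.

(** A core point and a point outside the core have all but finitely
    many core points between them in one of the orders. *)
Lemma two_cores u v : I u -> I v -> u <> v ->
  exists n m, [/\ I (Core n), I (Core m) & n < m].
Proof.
move=> Iu Iv uv; have [n In] := touch_core Iu Iv uv.
have [w Iw wn] : exists2 w, I w & w <> Core n.
  case: (pselect (u = Core n)) => [E|]; last by exists u.
  by exists v => // E'; apply: uv; rewrite E E'.
have up w' : I w' -> leM (Core n.+1) w' ->
    exists n m, [/\ I (Core n), I (Core m) & n < m].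
  move=> Iw' le; exists n, n.+1; split=> //.
  by apply: cM In Iw' _ le; rewrite /leM /pull_le /=; lia.
case: w Iw wn => [m|o|x|y] Iw wn; [|exact: up Iw _|exact: up Iw _|].
  case: (ltngtP n m) => [lt|lt|E]; [by exists n, m|by exists m, n|].
  by case: wn; rewrite E.
have [m E] := lkey_even 0 (lkey 0 n).+1.
have Im : I (Core m) by apply: (cL In Iw); rewrite /leL /pull_le //= E; lia.
case: (ltngtP n m) => [lt|lt|E']; [by exists n, m|by exists m, n|].
by move: E; rewrite E'; lia.
Qed.

(** The interval contains the whole core by [common_interval_core]; the points
    of [X] and [Y] lie between core points, and a hub lies between the core and
    a point of [X] or [Y]. *)
Lemma common_interval_full u v : I u -> I v -> u <> v -> forall w, I w.
Proof.
move=> Iu Iv uv; have [n0 [m0 [In Im nm]]] := two_cores Iu Iv uv.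
have IC n : I (Core n).
  apply: (common_interval_core (c := 0) (I := fun n => I (Core n)) _ _ In Im nm).
    move=> x y z Ix Iz /andP[xy yz].
    by apply: (cM Ix Iz); rewrite /leM /pull_le /=; lia.
  move=> x y z Ix Iz /andP[xy yz].
  by apply: (cL Ix Iz); rewrite /leL /pull_le /=; lia.
have IX x : I (InX x).
  have [m E] := lkey_even 0 0; have [n E'] := lkey_even 0 (nuX x + 2).
  by apply: (cL (IC m) (IC n)); rewrite /leL /pull_le /= ?E ?E'; lia.
have IY y : I (InY y).
  by apply: (cM (IC 0) (IC (2 * nuY y + 3))); rewrite /leM /pull_le /=; lia.
case=> // o; have [[x|y]] := hub_inner o; first exact: cM (IC 0) (IX x) _ _.
exact: cL (IC 0) (IY y) _ _.
Qed.

End CommonInterval.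

Section Endomorphism.
Variable f : point -> point.
Hypothesis fL : {homo f : u v / leL u v}.
Hypothesis fM : {homo f : u v / leM u v}.

Lemma frame_const_or_inj :
  (forall o o' : O, o = o') -> (O -> inhabited (X + Y)) ->
  injective f \/ exists c, f =1 (fun=> c).
Proof.
move=> hub_unique hub_inner; case: (pselect (injective f)) => [|ninj]; first by left.
have [u [v [fuv uv]]] : exists u v, f u = f v /\ u <> v.
  apply: contrapT => h; apply: ninj => u v fuv; apply: contrapT => uv.
  by apply: h; exists u, v.
right; exists (f u) => w.
apply: (common_interval_full (I := fun w => f w = f u) _ _ hub_unique hub_inner
  (erefl (f u)) (esym fuv) uv).
- move=> u1 v1 w1 Iu Iw uv1 vw1; apply: posL_inj; apply: wo_anti.
    by rewrite -Iw; exact: fL.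
  by rewrite -Iu; exact: fL.
- move=> u1 v1 w1 Iu Iw uv1 vw1; apply: posM_inj; apply: wo_anti.
    by rewrite -Iw; exact: fM.
  by rewrite -Iu; exact: fM.
Qed.

Hypothesis f_inj : injective f.

Lemma frameL_strict : strict (f : frameL -> frameL).
Proof. exact: homo_inj_strict. Qed.

Lemma frameM_strict : strict (f : frameM -> frameM).
Proof. exact: homo_inj_strict. Qed.

(** The core is fixed by [tail_rigid]. A point of [X] lies in [L] between two
    core points with no other point outside the core in between, so it is fixed
    as well, and likewise for [Y] with [M]; a hub has then no other place to
    go. *)
Lemma frame_core_id :
  (forall o o' : O, o = o') -> (forall n, exists m, f (Core n) = Core m) ->
  f =1 id.
Proof.
move=> hub_unique /choice[h fh].
have h_lt x y : x < y -> h x < h y.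
  move=> xy; have := frameM_strict (x := Core x) (y := Core y).
  rewrite !fh /wo_lt /= /pull_le /=; lia.
have h_key x y : lkey 0 x < lkey 0 y -> lkey 0 (h x) < lkey 0 (h y).
  move=> xy; have := frameL_strict (x := Core x) (y := Core y).
  rewrite !fh /wo_lt /= /pull_le /=; lia.
have [_ [j hj]] :=
  @tail_rigid 0 0 h 0 (fun x y _ => @h_lt x y) (fun x y _ _ => @h_key x y).
have h_id n : h n = n.
  apply: (@strict_fixed_below omega id h n (spinep 0 (j + n))).
  - by move=> x y xy _; rewrite ltnNge.
  - by move=> x y; rewrite /wo_lt /= -!ltnNge; exact: h_lt.
  - exact: hj.
  - by rewrite /= /spinep; lia.
have fC n : f (Core n) = Core n by rewrite fh h_id.
have nC v n : f v = Core n -> v = Core n.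
  by move=> E; apply: f_inj; rewrite E fC.
have fX x : f (InX x) = InX x.
  have [n En] := lkey_even 0 (nuX x).+1; have [m Em] := lkey_even 0 (nuX x + 2).
  have := fL (x := Core n) (y := InX x); have := fL (x := InX x) (y := Core m).
  rewrite !fC /leL /pull_le; case E: (f (InX x)) => [k|o'|x'|y'] /=.
  - by have := nC _ _ E.
  - by move/(_ ltac:(lia)).
  - by rewrite En Em => h1 h2; congr InX; apply: nuX_inj; lia.
  - by move/(_ ltac:(lia)).
have fY y : f (InY y) = InY y.
  have := fM (x := Core (2 * nuY y).+1) (y := InY y).
  have := fM (x := InY y) (y := Core (2 * nuY y + 3)).
  rewrite !fC /leM /pull_le; case E: (f (InY y)) => [k|o'|x'|y'] /=.
  - by have := nC _ _ E.
  - by move/(_ ltac:(lia)).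
  - by move/(_ ltac:(lia)).
  - by move=> h1 h2; congr InY; apply: nuY_inj; lia.
case=> // o; case E: (f (Hub o)) => [n|o'|x|y].
- by have := nC _ _ E.
- by rewrite (hub_unique o o').
- by have := f_inj (etrans E (esym (fX x))).
- by have := f_inj (etrans E (esym (fY y))).
Qed.

End Endomorphism.
End Frame.

Arguments Core {O X Y} _.
Arguments Hub {O X Y} _.
Arguments InX {O X Y} _.
Arguments InY {O X Y} _.
Arguments posL {O X Y} nuX v.
Arguments posM {O X Y} nuY v.
Arguments posL_inj {O X Y nuX} nuX_inj.
Arguments posM_inj {O X Y nuY} nuY_inj.
Arguments frameL O {X} Y {nuX} nuX_inj.
Arguments frameM O X {Y} {nuY} nuY_inj.
Arguments frameL_type {O X Y nuX} nuX_inj.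
Arguments frameM_type {O X Y nuY} nuY_inj.
Arguments frameL_strict {O X Y nuX} nuX_inj {f} fL f_inj.
Arguments frameM_strict {O X Y nuY} nuY_inj {f} fM f_inj.
Arguments frame_const_or_inj {O X Y nuX nuY} nuX_inj nuY_inj {f} fL fM.
Arguments frame_core_id {O X Y nuX nuY} nuX_inj nuY_inj {f} fL fM f_inj.

Lemma frame_orthogonal (O X Y : wotype) (nuX : X -> nat) (nuY : Y -> nat)
    (alpha beta : wotype) :
  injective nuX -> injective nuY ->
  (forall o o' : O, o = o') -> (O -> inhabited (X + Y)) ->
  ord_eq alpha (ord_add omega (ord_add O Y)) ->
  ord_eq beta (ord_add omega (ord_add O X)) ->
  (forall f : point O X Y -> point O X Y,
    {homo f : u v / pull_le (posL nuX) u v} ->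
    {homo f : u v / pull_le (posM nuY) u v} -> injective f -> f =1 id) ->
  ord_orthogonal alpha beta.
Proof.
move=> nuX_inj nuY_inj hub_unique hub_inner ea eb rigid.
exists (point O X Y), (pull_le (posL nuX)), (pull_le (posM nuY)); split.
- exact: (pull_total (posL_inj nuX_inj)).
- exact: (pull_total (posM_inj nuY_inj)).
- exact: (ord_eq_trans (frameL_type nuX_inj) (ord_eq_sym ea)).
- exact: (ord_eq_trans (frameM_type nuY_inj) (ord_eq_sym eb)).
move=> f fL fM; case: (frame_const_or_inj nuX_inj nuY_inj fL fM hub_unique hub_inner).
  by left; exact: rigid.
by right.
Qed.

(** * Both ordinals above omega *)

(** The hub is fixed because a point above it in [L] belongs to [Y], one above
    it in [M] to [X], and none to both. When [X] and [Y] are empty the hub would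
    leave the core as a common interval; one point of [X] and one of [Y], each
    last in one order, play its part. *)
Lemma orthogonal_above_omega (alpha beta : wotype)
    (na : alpha -> nat) (nb : beta -> nat) :
  injective na -> injective nb ->
  ord_le (ord_add omega ord_one) alpha -> ord_le (ord_add omega ord_one) beta ->
  ord_orthogonal alpha beta.
Proof.
move=> na_inj nb_inj [ea ea_init] [eb eb_init].
have ty (a : wotype) (e : ord_add omega ord_one -> a) (ei : initial_embedding e) :
    ord_eq a (ord_add omega (ord_add ord_one (tail_ord e))).
  by apply: ord_eq_sym; apply: ord_eq_trans (ord_addA _ _ _) (tail_ordP ei).
have tya := ty _ _ ea_init; have tyb := ty _ _ eb_init.
have unit_unique (o o' : ord_one) : o = o' by case: o; case: o'.
case: (pselect (inhabited (tail_ord eb + tail_ord ea))) => [inh|ninh].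
  have nX : injective (fun x : tail_ord eb => nb (val x)).
    by move=> x y /nb_inj/val_inj.
  have nY : injective (fun x : tail_ord ea => na (val x)).
    by move=> x y /na_inj/val_inj.
  apply: (frame_orthogonal nX nY unit_unique (fun=> inh) tya tyb) => f fL fM f_inj.
  apply: (frame_core_id nX nY fL fM f_inj unit_unique) => n.
  have fH : f (Hub (O := ord_one) tt) = Hub (O := ord_one) tt.
    have := strict_expand (frameL_strict nX fL f_inj) (Hub (O := ord_one) tt).
    have := strict_expand (frameM_strict nY fM f_inj) (Hub (O := ord_one) tt).
    by rewrite /= /pull_le; case: (f _) => [m|[]|x|y].
  have := frameL_strict nX fL f_inj (Core n) (Hub (O := ord_one) tt).
  have := frameM_strict nY fM f_inj (Core n) (Hub (O := ord_one) tt).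
  rewrite fH /wo_lt /= /pull_le; case: (f _) => [m|[]|x|y] /=.
  - by exists m.
  - by move=> /(_ isT).
  - by move=> /(_ isT).
  - by move=> _ /(_ isT).
have small (a : wotype) (e : ord_add omega ord_one -> a) :
    (tail_ord e -> False) ->
    ord_eq a (ord_add omega (ord_add ord_one (tail_ord e))) ->
    ord_eq a (ord_add omega (ord_add ord_zero ord_one)).
  move=> e0 h; apply: ord_eq_trans h _; apply: ord_eq_add (order_iso_refl _) _.
  apply: ord_eq_trans (ord_add_emptyr _ e0) (ord_eq_sym _).
  by apply: ord_add_emptyl; case.
have {}tya : ord_eq alpha (ord_add omega (ord_add ord_zero ord_one)).
  by apply: small tya => y; apply: ninh; constructor; right.
have {}tyb : ord_eq beta (ord_add omega (ord_add ord_zero ord_one)).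
  by apply: small tyb => y; apply: ninh; constructor; left.
have n_inj : injective (fun _ : ord_one => 0) by move=> x y _; exact: unit_unique.
have zero_unique (o o' : ord_zero) : o = o' by case: o.
apply: (frame_orthogonal n_inj n_inj zero_unique _ tya tyb) => [[]|f fL fM f_inj].
apply: (frame_core_id n_inj n_inj fL fM f_inj zero_unique) => n.
have fY : f (InY (Y := ord_one) tt) = InY (Y := ord_one) tt.
  have := strict_expand (frameL_strict n_inj fL f_inj) (InY (Y := ord_one) tt).
  by rewrite /= /pull_le; case: (f _) => [m|[]|x|[]].
have fX : f (InX (X := ord_one) tt) = InX (X := ord_one) tt.
  have := strict_expand (frameM_strict n_inj fM f_inj) (InX (X := ord_one) tt).
  by rewrite /= /pull_le; case: (f _) => [m|[]|[]|y].
have := frameL_strict n_inj fL f_inj (Core n) (InY (Y := ord_one) tt).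
have := frameM_strict n_inj fM f_inj (Core n) (InX (X := ord_one) tt).
rewrite fX fY /wo_lt /= /pull_le; case: (f _) => [m|[]|x|y] /=.
- by exists m.
- by move=> /(_ isT).
- by move=> _ /(_ isT).
Qed.

(** * Omega and an ordinal not of the form omega^omega . rho *)

Lemma omega_add_zeros (alpha : wotype) :
  ord_eq alpha omega -> ord_eq alpha (ord_add omega (ord_add ord_zero ord_zero)).
Proof.
move=> ea; apply: ord_eq_trans ea (ord_eq_sym _).
by apply: ord_add_emptyr => -[].
Qed.

Lemma void_nat_inj : injective (fun v : ord_zero => (match v with end : nat)).
Proof. by case. Qed.

Section Omega.
Variables (X : wotype) (nu : X -> nat).
Hypothesis nu_inj : injective nu.

Let pt := point ord_zero X ord_zero.

Definition keyL (v : pt) : nat :=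
  match v with
  | Core n => 2 * lkey 0 n | InX x => 4 * nu x + 5
  | Hub o => match o with end | InY y => match y with end
  end.

Lemma keyL_le (v w : frameL ord_zero ord_zero nu_inj) :
  wo_le v w = (keyL v <= keyL w).
Proof. by case: v w => [n|[]|x|[]] [m|[]|y|[]]. Qed.

Lemma omega_fixed_below (f : pt -> pt) v t :
  {homo f : u v / pull_le (posL nu) u v} -> injective f ->
  f t = t -> keyL v <= keyL t -> f v = v.
Proof.
move=> fL f_inj ft vt.
apply: (@strict_fixed_below (frameL ord_zero ord_zero nu_inj) keyL f v t) => //.
- by move=> y z; rewrite /wo_lt keyL_le -ltnNge.
- exact: (frameL_strict nu_inj fL f_inj).
- by rewrite keyL_le.
Qed.
End Omega.

Lemma zero_unique (o o' : ord_zero) : o = o'. Proof. by case: o. Qed.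

(** The key of the least point [c] of [X] is chosen minimal, so that [c] is
    [L]-below the last point [t], which is fixed; hence [c] is fixed, and the
    core is what precedes [c] in [M]. *)
Lemma orthogonal_omega_succ (alpha beta X : wotype) (n : X -> nat) (t : X) :
  injective n -> (forall x, wo_le x t) ->
  ord_eq alpha omega -> ord_eq beta (ord_add omega X) ->
  ord_orthogonal alpha beta.
Proof.
move=> n_inj tmax ea eb.
have [c _ cmin] := @wo_minimum X (fun=> True) (ex_intro _ t I).
pose nu (x : X) := if `[< x = c >] then 0 else (n x).+1.
have nu_inj : injective nu.
  move=> x y; rewrite /nu; case: asboolP => [->|_]; case: asboolP => [->|_] //.
  by move=> [/n_inj].
have nuc : nu c = 0 by rewrite /nu; case: asboolP.
have {}eb : ord_eq beta (ord_add omega (ord_add ord_zero X)).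
  apply: ord_eq_trans eb _; apply: ord_eq_add (order_iso_refl _) (ord_eq_sym _).
  by apply: ord_add_emptyl; case.
apply: (frame_orthogonal nu_inj void_nat_inj zero_unique _ (omega_add_zeros ea) eb).
  by case.
move=> f fL fM f_inj.
apply: (frame_core_id nu_inj void_nat_inj fL fM f_inj zero_unique) => k.
have ft : f (InX t) = InX t.
  have := strict_expand (frameM_strict void_nat_inj fM f_inj) (InX t).
  rewrite /= /pull_le; case: (f _) => [m|[]|x|[]] //= tx.
  by congr InX; exact: wo_anti.
have fc : f (InX c) = InX c.
  by apply: (omega_fixed_below nu_inj fL f_inj ft); rewrite /= nuc; lia.
have := frameM_strict void_nat_inj fM f_inj (Core k) (InX c).
rewrite fc /wo_lt /= /pull_le; case: (f _) => [m|[]|x|[]] /=; first by exists m.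
by rewrite cmin // => /(_ isT).
Qed.

(** If no tail of a block stays in one block, every block has a subsequence along
    which the block of the image increases strictly; the concatenation of
    these subsequences is strictly increasing because a value in a block is
    exceeded by a later one of the same block. *)
Lemma block_dichotomy (gamma : wotype)
    (F : ord_mul omega gamma -> ord_mul omega gamma) :
  {homo F : u v / wo_le u v} ->
  (exists w w' N, forall n, N <= n -> (F (w, n)).1 = w') \/
  exists h : ord_mul omega gamma -> gamma, strict h.
Proof.
move=> hF.
have [|nb] := pselect (exists w w' N, forall n, N <= n -> (F (w, n)).1 = w').
  by left.
right.
have F1 u v : wo_le u v -> wo_le (F u).1 (F v).1 by move/hF => /andP[].
have leF w n m : n <= m -> wo_le (F (w, n)).1 (F (w, m)).1.
  by move=> nm; apply: F1; rewrite /= /lexi_le /= wo_refl.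
have /choice[g gP] : forall u : gamma * nat, exists m,
    wo_lt (F u).1 (F (u.1, m)).1.
  move=> [w n]; apply: contrapT => h; apply: nb; exists w, (F (w, n)).1, n => m nm.
  apply: contrapT => ne; apply: h; exists m.
  apply: wo_le_neq_lt; [exact: leF | exact: nesym].
pose sub w i := iter i (fun n => g (w, n)) 0.
exists (fun u => (F (u.1, sub u.1 u.2)).1).
have step w i : wo_lt (F (w, sub w i)).1 (F (w, sub w i.+1)).1.
  exact: (gP (w, sub w i)).
move=> [w i] [w' i'] /lexi_lt /= [ww'|[<-]].
  apply: wo_lt_le_trans (step w i) _; apply: F1.
  by apply: wo_ltW; apply/lexi_lt; left.
rewrite /wo_lt /= -ltnNge; elim: i' => // i' IH.
rewrite ltnS leq_eqVlt => /orP[/eqP ->|/IH lt]; first exact: step.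
exact: wo_lt_trans lt (step _ _).
Qed.

(** Such an [h] makes omega . beta embed into beta, hence into a proper initial
    segment of itself. *)
Lemma no_omega_contraction (beta gamma : wotype)
    (h : ord_mul omega gamma -> gamma) :
  strict h -> ord_eq (ord_mul omega gamma) beta ->
  ~ ord_lt beta (ord_mul omega beta).
Proof.
move=> sh eb [e [em ei] [y ny]].
have [s ss] := ord_eq_strict eb; have [r sr] := ord_eq_strict (ord_eq_sym eb).
pose G (u : ord_mul omega beta) : beta := s (h (r u.1), u.2).
have sG : strict G.
  move=> u v uv; apply: ss; apply/lexi_lt => /=.
  case/lexi_lt: uv => [lt|[-> lt]]; [left|by right].
  apply: sh; exact: sr.
have se := mono_strict em.
have /negP[] : wo_lt (e (G y)) y.
  by apply/negP => /ei[z /ny].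
exact: (@strict_expand _ (fun u => e (G u)) (fun u v uv => se _ _ (sG _ _ uv))).
Qed.

Section OmegaLimit.
Variables (gamma1 : wotype) (mu : gamma1 -> nat).
Hypothesis mu_inj : injective mu.

Let X := ord_mul omega gamma1.
Let gamma := ord_add ord_one gamma1.
Let pt := point ord_zero X ord_zero.

(** The core is the first of the gamma blocks, whence the form 1 + gamma1 of
    gamma. *)
Definition colour (w : gamma) : nat :=
  match w with inl _ => 0 | inr w => (mu w).+1 end.

Lemma colour_inj : injective colour.
Proof. by case=> [[]|w] [[]|v] //= [/mu_inj ->]. Qed.

(** Powers of 2 times odd numbers: injective in both coordinates together, and
    increasing in [lkey] inside a block, so that each block is a copy of the
    rigid bichain of its colour. *)
Definition limit_key (x : X) : nat :=
  2 ^ mu x.1 * (2 * lkey (mu x.1).+1 x.2 + 1).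

Lemma limit_key_inj : injective limit_key.
Proof.
have odd_part a b x y : 2 ^ a * (2 * x + 1) = 2 ^ b * (2 * y + 1) -> a = b /\ x = y.
  elim: a b => [|a IH] [|b]; rewrite ?expnS ?expn0.
  - by lia.
  - by rewrite -mulnA; lia.
  - by rewrite -mulnA; lia.
  - rewrite -!mulnA => E; have [|-> ->//] := IH b; by lia.
move=> [w n] [v m] /odd_part /= [/mu_inj E]; rewrite {}E.
by move/lkey_inj ->.
Qed.

Definition cell (u : ord_mul omega gamma) : pt :=
  match u.1 with inl _ => Core u.2 | inr w => InX ((w, u.2) : X) end.

Definition cell_inv (v : pt) : ord_mul omega gamma :=
  match v with
  | Core n => (inl tt, n)
  | InX x => (inr x.1, x.2)
  | Hub o => match o with end
  | InY y => match y with end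
  end.

Lemma cell_invK v : cell (cell_inv v) = v.
Proof. by case: v => [n|[]|[w n]|[]]. Qed.

Lemma cell_strict :
  strict (cell : _ -> frameM ord_zero X void_nat_inj).
Proof.
move=> [w n] [v m] /lexi_lt /= [lt|[<- lt]]; last first.
  case: w => [[]|w]; rewrite /wo_lt /= /pull_le /=.
    by move: lt; rewrite /wo_lt /=; lia.
  by apply/lexi_lt; right.
case: w v lt => [[]|w] [[]|v] //= lt.
by apply/lexi_lt; left.
Qed.

Lemma cell_keyL w n m :
  (keyL limit_key (cell (w, n)) < keyL limit_key (cell (w, m))) =
  (lkey (colour w) n < lkey (colour w) m).
Proof.
case: w => [[]|w] /=; first by lia.
rewrite /limit_key /=; have := expn_gt0 2 (mu w); set p := 2 ^ mu w => p0.
by rewrite ltn_add2r ltn_pmul2l // ltn_pmul2l // ltn_add2r ltn_pmul2l.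
Qed.

Lemma cell_keyL_ge w n : lkey (colour w) n <= keyL limit_key (cell (w, n)).
Proof.
case: w => [[]|w] /=; first by lia.
rewrite /limit_key /=; have := expn_gt0 2 (mu w); set p := 2 ^ mu w => p0.
by nia.
Qed.

Lemma orthogonal_omega_limit (alpha beta : wotype) :
  ord_eq alpha omega -> ord_eq beta (ord_add omega X) ->
  ord_lt beta (ord_mul omega beta) -> ord_orthogonal alpha beta.
Proof.
move=> ea eb lt_beta.
have {}eb : ord_eq beta (ord_add omega (ord_add ord_zero X)).
  apply: ord_eq_trans eb _; apply: ord_eq_add (order_iso_refl _) (ord_eq_sym _).
  by apply: ord_add_emptyl; case.
apply: (frame_orthogonal limit_key_inj void_nat_inj zero_unique _
  (omega_add_zeros ea) eb).
  by case.
move=> f fL fM f_inj.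
have sL := frameL_strict limit_key_inj fL f_inj.
have sM := frameM_strict void_nat_inj fM f_inj.
have keyL_f u v : keyL limit_key u < keyL limit_key v ->
    keyL limit_key (f u) < keyL limit_key (f v).
  have := sL u v; rewrite /wo_lt !keyL_le -!ltnNge; exact.
pose F u := cell_inv (f (cell u)).
have cellF u : cell (F u) = f (cell u) by rewrite cell_invK.
have sF : strict F.
  move=> u v uv; rewrite /wo_lt -(strict_mono cell_strict) !cellF.
  by apply: sM; exact: cell_strict.
have hF : {homo F : u v / wo_le u v} by move=> u v; rewrite (strict_mono sF).
have [[w [w' [N FN]]]|[h sh]] := block_dichotomy hF; last first.
  case: (no_omega_contraction sh _ lt_beta).
  apply: ord_eq_trans (ord_eq_trans (frameM_type void_nat_inj) (ord_eq_sym eb)).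
  by apply: (strict_iso cell_strict) => v; exists (cell_inv v); exact: cell_invK.
pose g n := (F (w, n)).2.
have cellg n : N <= n -> f (cell (w, n)) = cell (w', g n).
  by move=> Nn; rewrite -cellF -(FN n Nn) /g; case: (F _).
have g_lt x y : N <= x -> x < y -> g x < g y.
  move=> Nx xy; have Ny : N <= y by lia.
  have : wo_lt (F (w, x)) (F (w, y)).
    by apply: sF; apply/lexi_lt; right; split=> //; rewrite /wo_lt /= -ltnNge.
  case/lexi_lt => [|[_]]; first by rewrite (FN _ Nx) (FN _ Ny) => /wo_ltxx.
  by rewrite /wo_lt /= -ltnNge.
have g_key x y : N <= x -> N <= y ->
    lkey (colour w) x < lkey (colour w) y ->
    lkey (colour w') (g x) < lkey (colour w') (g y).
  by move=> Nx Ny; rewrite -!cell_keyL -!cellg //; exact: keyL_f.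
have [/colour_inj ww' [j0 gj]] := tail_rigid g_lt g_key.
move=> v; pose n := spinep (colour w) (j0 + (N + keyL limit_key v)).
apply: (omega_fixed_below limit_key_inj fL f_inj (t := cell (w, n))).
  by rewrite cellg ?gj -?ww' // /n /spinep; lia.
by apply: leq_trans (cell_keyL_ge _ _); rewrite lkey_p; lia.
Qed.
End OmegaLimit.

(** * Omega is not orthogonal to a multiple of omega^omega *)

(** The image of the [n]-th point is taken in the copy of omega attached to that
    point, beyond the images already chosen and beyond the [n]-th point itself;
    the last condition excludes the identity. *)
Lemma not_orthogonal_omega (alpha beta : wotype) :
  ord_eq alpha omega -> ord_le (ord_mul omega beta) beta ->
  ~ ord_orthogonal alpha beta.
Proof.
move=> ea [e [em _]] [V [L [M [_ _ iL iM rigid]]]].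
have [phi [psi phiK psiK] phiL] := order_iso_trans iL ea.
have [rho [tau rhoK tauK] rhoM] := iM.
have se := mono_strict em.
have /choice[next nextP] : forall u : V * nat, exists v,
    u.2 < phi v /\ exists i : nat, rho v = e (rho u.1, i).
  move=> [v N] /=; apply: contrapT => h.
  pose k i := phi (tau (e (rho v, i : nat))).
  have kN (i : nat) : k i < N.+1.
    rewrite ltnS leqNgt; apply/negP => lt; apply: h.
    by exists (tau (e (rho v, i))); split=> //; exists i; rewrite tauK.
  (* Infinitely many candidates cannot all lie at position at most N. *)
  have k_inj : injective (fun i : 'I_N.+2 => Ordinal (kN i)).
    move=> i j [] /(can_inj phiK)/(can_inj tauK)/(strict_inj se) [] E.
    exact: val_inj.
  by have := leq_card _ k_inj; rewrite !card_ord ltnn.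
pose u := fix u n := match n with
  | 0 => next (psi 0, 0)
  | n.+1 => next (psi n.+1, maxn n.+1 (phi (u n))) end.
have u_step n : phi (u n) < phi (u n.+1).
  have [/=] := nextP (psi n.+1, maxn n.+1 (phi (u n))).
  by rewrite gtn_max => /andP[].
have u_gt n : n < phi (u n).
  case: n => [|n]; first by have [] := nextP (psi 0, 0).
  have [/=] := nextP (psi n.+1, maxn n.+1 (phi (u n))).
  by rewrite gtn_max => /andP[].
have u_block n : exists i : nat, rho (u n) = e (rho (psi n), i).
  case: n => [|n]; first by have [] := nextP (psi 0, 0).
  by have [] := nextP (psi n.+1, maxn n.+1 (phi (u n))).
have u_mono n m : n <= m -> phi (u n) <= phi (u m).
  elim: m => [|m IH]; first by rewrite leqn0 => /eqP ->.
  rewrite leq_eqVlt => /orP[/eqP -> //|/IH le].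
  exact: leq_trans le (ltnW (u_step m)).
case: (rigid (fun v => u (phi v))).
- by move=> x y; rewrite -!phiL /=; exact: u_mono.
- move=> x y; rewrite -!rhoM => xy.
  have [i Ei] := u_block (phi x); have [j Ej] := u_block (phi y).
  case: (pselect (x = y)) => [->|ne]; first exact: wo_refl.
  rewrite Ei Ej !phiK em; apply: wo_ltW; apply/lexi_lt; left.
  by apply: wo_le_neq_lt xy _ => /(can_inj rhoK).
- by move=> /(_ (psi 0)); have := u_gt 0; rewrite psiK => /[swap] ->; rewrite psiK.
- move=> [c fc]; have := u_step 0.
  by have := fc (psi 0); have := fc (psi 1); rewrite !psiK => -> ->; rewrite ltnn.
Qed.

Lemma omega_le_infinite (alpha : wotype) (g : nat -> alpha) :
  injective g -> ord_le omega alpha.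
Proof.
move=> g_inj; case: (ord_total omega alpha) => // -[e [em ei] [y ny]].
have se := mono_strict em.
have lt (i : nat) : e (g i) < y.
  by rewrite ltnNge; apply/negP => /ei[z /ny].
have k_inj : injective (fun i : 'I_y.+1 => Ordinal (lt i)).
  by move=> i j [] /(strict_inj se)/g_inj/val_inj.
by have := leq_card _ k_inj; rewrite !card_ord ltnn.
Qed.

Lemma ord_le_trans (b a c : wotype) : ord_le a b -> ord_le b c -> ord_le a c.
Proof.
move=> [f [fm fi]] [g [gm gi]]; exists (g \o f); split=> [x y|x z] /=.
  by rewrite gm fm.
by move=> le; have [y E] := gi _ _ le; move: le; rewrite -E gm => /fi[t <-]; exists t.
Qed.

Lemma ord_eq_le (a b : wotype) : ord_eq a b -> ord_le a b.
Proof.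
by move=> [f [g fK gK] fm]; exists f; split=> // x y _; exists (g y).
Qed.

(** The first omega points of [alpha] are either all of it or followed by a
    further point. *)
Lemma infinite_cases (alpha : wotype) (g : nat -> alpha) : injective g ->
  ord_eq alpha omega \/ ord_le (ord_add omega ord_one) alpha.
Proof.
move=> /omega_le_infinite[e ei]; have ty := tail_ordP ei.
case: (pselect (inhabited (tail_ord e))) => [[x]|nx]; [right|left].
  have [f [fm fi]] := ord_le_one x.
  apply: ord_le_trans (ord_eq_le ty).
  exists (fun u => match u with inl n => inl n | inr o => inr (f o) end); split.
    by case=> [?|?] [?|?] //=; exact: fm.
  case=> [n|o] [m|z] //= le; first by exists (inl m).
    by exists (inl m).
  by have [t <-] := fi o z le; exists (inr t).
apply: ord_eq_trans (ord_eq_sym ty) _; apply: ord_add_emptyr => x.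
by apply: nx; constructor.
Qed.

Local Open Scope classical_set_scope.
Local Open Scope card_scope.

Theorem theorem1 (alpha beta : wotype)
    (halpha : [set: alpha] #= [set: nat])
    (hbeta : [set: beta] #= [set: nat])
    (hle : ord_le alpha beta) :
  ord_orthogonal alpha beta <->
  ord_le (ord_add omega ord_one) alpha \/
  (ord_eq alpha omega /\ ord_lt beta (ord_mul omega beta)).
Proof.
have inj_of (a : wotype) : [set: a] #= [set: nat] ->
    (exists n : a -> nat, injective n) /\ (exists g : nat -> a, injective g).
  move=> /card_set_bijP[n [_ n_inj n_surj]]; split.
    by exists n => x y; apply: n_inj; rewrite inE.
  have /choice[g gK] m : exists x, n x = m.
    by have [x _ <-] := n_surj m Logic.I; exists x.
  by exists g; exact: can_inj gK.
have [[na na_inj] [ga ga_inj]] := inj_of _ halpha.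
have [[nb nb_inj] [gb gb_inj]] := inj_of _ hbeta.
split=> [orth|[le|[ea lt]]].
- have [ea|] := infinite_cases ga_inj; [right; split=> //|by left].
  have [le|//] := ord_total (ord_mul omega beta) beta.
  by case: (not_orthogonal_omega ea le).
- exact: (orthogonal_above_omega na_inj nb_inj le (ord_le_trans le hle)).
have [e ei] := omega_le_infinite gb_inj.
have eb := ord_eq_sym (tail_ordP ei).
have nX : injective (fun x : tail_ord e => nb (val x)) by move=> x y /nb_inj/val_inj.
have [[t tmax]|no_max] := pselect (exists t : tail_ord e, forall x, wo_le x t).
  exact: orthogonal_omega_succ nX tmax ea eb.
have lim (x : tail_ord e) : exists y, wo_lt x y.
  apply: contrapT => h; apply: no_max; exists x => y; apply/negPn/negP => lt'.
  by apply: h; exists y.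
have mu_inj : injective (fun x : limit_points (tail_ord e) => nb (val (val x))).
  by move=> x y /nX/val_inj.
apply: (orthogonal_omega_limit mu_inj ea _ lt).
apply: ord_eq_trans eb (ord_eq_add (order_iso_refl _) _).
exact: ord_eq_sym (limit_decomposition lim).
Qed.
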